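(* Let $(F_n)_{n\ge 0}$ be the Fibonacci numbers. For every integer $m\ge 2$ the following identities hold: \begin{align*} &\left( \sum_{k=1}^{2m - 1} (-1)^{k-1} F_k^3\right) F_{2m-1}^3 + \left( \sum_{k=2}^{2m-2} F_{k}^3 \right) F_{2m}^3 \ = \ \frac{(F_{2m-1}^3 - 1) (F_{2m}^3 - 1)}{2}, \\ &1 + \left( \sum_{k=1}^{2m} (-1)^{k} F_k^3 - 1\right) F_{2m}^3 + \left( \sum_{k=2}^{2m-1} F_{k}^3 \right) F_{2m+1}^3 \ = \ \frac{(F_{2m}^3 - 1) (F_{2m+1}^3 - 1)}{2}. \end{align*}
   Context: The Fibonacci numbers are defined by $F_0=0$, $F_1=1$, and $F_n=F_{n-1}+F_{n-2}$ for $n\ge 2$. *)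

(* Defs.v *)
From mathcomp Require Import all_boot all_order all_algebra.
Set Implicit Arguments.
Unset Strict Implicit.
Unset Printing Implicit Defensive.

Fixpoint fib (n : nat) : nat :=
  match n with
  | 0 => 0
  | n'.+1 => match n' with
             | 0 => 1
             | n''.+1 => fib n' + fib n''
             end
  end.

(* Main.v *)
(** Write [a, b] for two consecutive Fibonacci numbers [F_n, F_(n+1)].  The
    partial sums of [F_k^3] and of [(-1)^k F_k^3] telescope to an affine function
    of a cubic form in [a, b]; the two forms are found by solving the linear
    systems [P(b, a+b) - P(a, b) = b^3] and [Q(b, a+b) + Q(a, b) = b^3].  After
    substitution both identities become the statement that one sextic form in
    [a, b] equals [(-1)^n]; that form is the cube of Cassini's
    [b^2 - a b - a^2 = (-1)^n]. *)
Require Import Defs.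
From mathcomp Require Import all_boot all_order all_algebra.
From mathcomp Require Import ring lra zify.
Import Order.TTheory GRing.Theory Num.Theory.
Local Open Scope ring_scope.

Lemma fibSS (n : nat) : fib n.+2 = (fib n.+1 + fib n)%N.
Proof. by []. Qed.

(** The form changes sign under [(a, b) -> (b, a + b)]. *)
Lemma fib_cassini (R : comPzRingType) (n : nat) :
  (fib n.+1)%:R ^+ 2 - (fib n)%:R * (fib n.+1)%:R - (fib n)%:R ^+ 2
  = (-1) ^+ n :> R.
Proof.
elim: n => [|n IHn]; first by rewrite /=; ring.
by rewrite fibSS natrD [in RHS]exprS -IHn; ring.
Qed.

(** The factor 2 clears the denominator, so the formula makes sense in any commutative ring. *)
Lemma sum_fib_cube (R : comPzRingType) (n : nat) :
  2%:R * (\sum_(1 <= k < n.+1) (fib k)%:R ^+ 3)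
  = 1 - (fib n)%:R ^+ 3 + 3%:R * (fib n)%:R * (fib n.+1)%:R ^+ 2
    - (fib n.+1)%:R ^+ 3 :> R.
Proof.
elim: n => [|n IHn]; first by rewrite big_geq //=; ring.
by rewrite big_nat_recr //= mulrDr IHn -/(fib n.+1) natrD; ring.
Qed.

Lemma sum_alt_fib_cube (R : comPzRingType) (n : nat) :
  2%:R * (\sum_(1 <= k < n.+1) (-1) ^+ k * (fib k)%:R ^+ 3)
  = 1 + (-1) ^+ n * ((fib n)%:R ^+ 3 + 3%:R * (fib n)%:R ^+ 2 * (fib n.+1)%:R
                     - (fib n.+1)%:R ^+ 3) :> R.
Proof.
elim: n => [|n IHn]; first by rewrite big_geq //= expr0; ring.
by rewrite big_nat_recr //= mulrDr IHn -/(fib n.+1) natrD !(exprS (-1)); ring.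
Qed.

Lemma fib_sextic (R : comPzRingType) (n : nat) :
  let a : R := (fib n)%:R in
  let b : R := (fib n.+1)%:R in
  let c : R := (fib n.+2)%:R in
  (b ^+ 3 + 3%:R * b ^+ 2 * c - c ^+ 3) * b ^+ 3
    + (- a ^+ 3 + 3%:R * a * b ^+ 2 - b ^+ 3) * c ^+ 3
  = b ^+ 3 * c ^+ 3 + (-1) ^+ n.
Proof.
move=> a b c; have -> : (-1) ^+ n = (b ^+ 2 - a * b - a ^+ 2) ^+ 3 :> R.
  by rewrite fib_cassini -exprM mulnC exprM; congr (_ ^+ _); ring.
by rewrite /c fibSS natrD -/a -/b; ring.
Qed.

Theorem theorem1p5 (m : nat) (hm : (2 <= m)%N) :
  let F (n : nat) : rat := (fib n)%:R in
  (\sum_(1 <= k < (2 * m - 1).+1) (-1) ^+ (k - 1) * F k ^+ 3)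
      * F (2 * m - 1)%N ^+ 3
    + (\sum_(2 <= k < (2 * m - 2).+1) F k ^+ 3) * F (2 * m)%N ^+ 3
  = (F (2 * m - 1)%N ^+ 3 - 1) * (F (2 * m)%N ^+ 3 - 1) / 2%:R
  /\
  1 + ((\sum_(1 <= k < (2 * m).+1) (-1) ^+ k * F k ^+ 3) - 1)
      * F (2 * m)%N ^+ 3
    + (\sum_(2 <= k < (2 * m - 1).+1) F k ^+ 3) * F (2 * m + 1)%N ^+ 3
  = (F (2 * m)%N ^+ 3 - 1) * (F (2 * m + 1)%N ^+ 3 - 1) / 2%:R.
Proof.
move=> F.
have sum2 n : (0 < n)%N -> \sum_(2 <= k < n.+1) F k ^+ 3
                 = \sum_(1 <= k < n.+1) F k ^+ 3 - 1.
  by move=> n_gt0; rewrite [in RHS]big_ltn //= /F /=; ring.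
have sumN n : \sum_(1 <= k < n.+1) (-1) ^+ (k - 1) * F k ^+ 3
              = - \sum_(1 <= k < n.+1) (-1) ^+ k * F k ^+ 3.
  (* The range excludes [k = 0], where [k - 1] would truncate. *)
  rewrite -sumrN; apply: eq_big_nat => -[|k] // _.
  by rewrite subn1 (exprS (-1)) /=; ring.
have signE (p : nat) : (-1) ^+ (2 * p) = 1 :> rat.
  by rewrite exprM sqrrN expr1n.
case: m hm => [|[|p]] // _.
have -> : (2 * p.+2 - 1 = (2 * p.+1).+1)%N by lia.
have -> : (2 * p.+2 - 2 = 2 * p.+1)%N by lia.
have -> : (2 * p.+2 + 1 = (2 * p.+1).+3)%N by lia.
have -> : (2 * p.+2 = (2 * p.+1).+2)%N by lia.
(* Of [n = 2m - 2], only positivity (for [sum2]) and evenness (kept as [en]) matter. *)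
rewrite sumN !sum2 //; move: (2 * p.+1)%N (signE p.+1) => n en.
have half (x y : rat) : 2%:R * x = y -> x = y / 2%:R by move=> <-; field.
rewrite !(half _ _ (sum_fib_cube _ _)) !(half _ _ (sum_alt_fib_cube _ _)).
(* Once doubled and expanded, the first identity is the sextic relation at [n] (sign +1), the second
   the one at [n.+1] (sign -1). *)
have := fib_sextic rat n.+1; have := fib_sextic rat n.
rewrite !(exprS (-1)) en => sextic_n sextic_Sn.
cbv zeta in sextic_n, sextic_Sn; by split; rewrite /F; lra.
Qed.
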